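(* Let $X$ be a separated topological space. Then $X$ is completely normal if and only if, for every closed subset $A$ of $X$, every upper semicontinuous multi-valued map $T$ from $A$ into $[0,1]$ with nonempty closed convex values has an extension to an upper semicontinuous multi-valued map $\widetilde{T}$ from the whole of $X$ into $[0,1]$ with nonempty closed convex values (that is, $\widetilde{T}(x)=T(x)$ for every $x\in A$).
   Context: Separated means Hausdorff. Subsets are endowed with the induced topology; $[0,1]$ is the unit real interval with its usual topology. A multi-valued map $T$ from a space $E_1$ into a space $E_2$ assigns to each $x\in E_1$ a subset $T(x)\subset E_2$. It is upper semicontinuous if for every $x_0\in E_1$ and every open subset $V$ of $E_2$ with $T(x_0)\subset V$ there is a neighborhood $O$ of $x_0$ in $E_1$ such that $T(x)\subset V$ for all $x\in O$. A separated space is completely normal if every subspace of it is normal (equivalently, any subsets $P,Q$ with $\overline{P}\cap Q=P\cap\overline{Q}=\emptyset$ can be separated by disjoint open sets). *)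

(* Defs.v *)
From mathcomp Require Import all_boot all_order all_algebra.
From mathcomp Require Import all_classical all_reals all_analysis.

Set Implicit Arguments.
Unset Strict Implicit.
Unset Printing Implicit Defensive.

Import numFieldNormedType.Exports.
Local Open Scope classical_set_scope.
Local Open Scope ring_scope.

(* A subset S of a topological space, used as a type through the coercion
   [set_type], carries the induced topology.  [normal_space] only asserts the
   separation of closed sets; Hausdorffness of the ambient space is always
   assumed separately and is inherited by subspaces. *)
Definition completely_normal (X : topologicalType) : Prop :=
  forall S : set X, normal_space S.

(* A multi-valued map from E1 into E2 is a function E1 -> set E2; empty values
   are allowed unless excluded explicitly. *)
Definition upper_semicontinuous (E1 E2 : topologicalType)
    (T : E1 -> set E2) : Prop :=
  forall (x0 : E1) (V : set E2), open V -> T x0 `<=` V ->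
    \forall x \near x0, T x `<=` V.

Definition unit_interval (R : realType) : set R := `[0, 1].

Arguments unit_interval : clear implicits.

(* [C] is closed in the induced topology of [0, 1]; since the type [0, 1] is
   not itself a vector space, convexity is that of the image of [C] in R. *)
Definition nonempty_closed_convex (R : realType)
    (C : set (unit_interval R)) : Prop :=
  [/\ C !=set0, closed C & @convex_set R R^o (set_val @` C)].

(* Main.v *)
Require Import Defs.
From mathcomp Require Import all_boot all_order all_algebra.
From mathcomp Require Import all_classical all_reals all_analysis.
From mathcomp Require Import ring.
Import numFieldNormedType.Exports.
Import Order.TTheory GRing.Theory Num.Theory.
Local Open Scope classical_set_scope.

(* For a dense sequence [q] of [0, 1], the sets P_n = {x in A | T x > q_n} and
   Q_n = {x in A | T x < q_n} are disjoint and open in A, hence separated in X,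
   and complete normality provides open G_n containing P_n with closure G_n
   disjoint from Q_n.  Inserting them one at a time, Urysohn-style, makes G_n
   decrease when q_n increases.  With U_n = G_n \ (A \ P_n) and
   V_n = X \ closure G_n \ (A \ Q_n), the extension sends x to the set of all y
   such that q_n <= y whenever x in U_n, and y <= q_n whenever x in V_n: it is
   upper semicontinuous since [0, 1] is compact and U_n, V_n are open, and
   nonempty since the constraints q_n <= y and y <= q_m with q_m < q_n are never
   active at the same point.

   Conversely, if P and Q are separated, then on A = closure (P u Q) the map
   equal to {1} off closure Q, to {0} off closure P and to [0, 1] elsewhere is
   upper semicontinuous, and any extension S of it separates P and Q by the open
   sets {S > 1/2} and {S < 1/2}. *)

(** * Compactness and upper semicontinuity *)

Lemma compact_setT_set_type {T : topologicalType} (K : set T) :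
  compact K -> compact [set: K].
Proof.
move=> /compact_near_coveringP cK; apply/compact_near_coveringP.
move=> I F P FF cover.
(* Quantifying over the [y : K] of value [x'] makes the property meaningful, and vacuous, at points
   outside [K]. *)
have nearP (x : T) : K x ->
    \forall x' \near x & i \near F, forall y : K, set_val y = x' -> P i y.
  move=> Kx; have [[N M] /= [[_ [[ O oO <-] /= Ox] sON] FM] sNM] :=
    cover (SigSub (mem_set Kx)) Logic.I.
  exists (O, M); first by split => //=; exact: open_nbhs_nbhs.
  move=> [x' i] /= [Ox' Mi] y yx'; apply: (sNM (y, i)); split => //=.
  by apply: sON; rewrite /= yx'.
apply: filterS (cK I F _ FF nearP) => i Pi y _.
exact: Pi (set_valP y) _ erefl.
Qed.

(* The graph of the intersection map is closed, and a closed graph in a product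
   with a compact second factor gives upper semicontinuity. *)
Lemma upper_semicontinuous_bigcap {E1 E2 : topologicalType} {I : Type}
    (O : I -> set E1) (K : I -> set E2) :
  compact [set: E2] -> (forall i, open (O i)) -> (forall i, closed (K i)) ->
  upper_semicontinuous (fun x => \bigcap_(i in [set i | O i x]) K i).
Proof.
move=> cE oO cK x V oV sV.
have /compact_near_coveringP cV : compact (~` V).
  by apply: (subclosed_compact _ cE) => //; exact: open_closedC.
have nearV (y : E2) : (~` V) y -> \forall y' \near y & x' \near x,
    ~ (\bigcap_(i in [set i | O i x']) K i) y'.
  move=> nVy; have /existsNP[i /not_implyP[Oix nKiy]] :
      ~ (\bigcap_(i in [set i | O i x]) K i) y by move/sV.
  exists (~` K i, O i) => /=.
    by split; apply: open_nbhs_nbhs; split => //; exact: closed_openC.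
  by move=> [y' x'] /= [nK Ox'] /(_ i Ox').
pose bad x' y := ~ (\bigcap_(i in [set i | O i x']) K i) y.
apply: filterS (cV E1 (nbhs x) bad _ nearV) => x' sV' y Ky.
by apply: contrapT => nVy; exact: sV' nVy Ky.
Qed.

(** Upper semicontinuity at each of its points makes [[set x | T x]<=[V]] open in [A], hence the
    trace of an open set of [X]. *)
Lemma upper_semicontinuous_trace {X E : topologicalType} {A : set X}
    {T : A -> set E} (V : set E) : upper_semicontinuous T -> open V ->
  exists2 O : set X, open O & forall x : A, O (set_val x) <-> T x `<=` V.
Proof.
move=> uT oV; have : open [set x : A | T x `<=` V].
  by rewrite openE => x /= TxV; exact: uT.
case=> O oO eqO; exists O => // x.
by rewrite -[T x `<=` V]/([set x | T x `<=` V] x) -eqO.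
Qed.

(** * Normality and separated sets *)

Lemma normal_space_separation {X : topologicalType} (A B : set X) :
  normal_space X -> closed A -> closed B -> A `&` B = set0 ->
  exists2 G, open G & A `<=` G /\ closure G `&` B = set0.
Proof.
move=> nX cA cB AB0; have : set_nbhs A (~` B).
  apply/set_nbhsP; exists (~` B); split => //; first exact: closed_openC.
  by rewrite -disjoints_subset.
move=> /(nX A cA)[C /set_nbhsP[G [oG AG GC]] CB]; exists G => //; split => //.
by rewrite disjoints_subset; apply: subset_trans CB; exact: closureS.
Qed.

(* Normality is applied to the open subspace [~` (closure P `&` closure Q)], in
   which the closures of [P] and [Q] are disjoint. *)
Lemma completely_normal_separation {X : topologicalType} (P Q : set X) :
  completely_normal X -> closure P `&` Q = set0 -> P `&` closure Q = set0 ->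
  exists2 G, open G & P `<=` G /\ closure G `&` Q = set0.
Proof.
move=> cnX PQ0 QP0; pose S := ~` (closure P `&` closure Q).
have oS : open S by apply: closed_openC; apply: closedI; exact: closed_closure.
have SP x : P x -> S x.
  move=> Px [_ Qx]; suff : (P `&` closure Q) x by rewrite QP0.
  by [].
have SQ x : Q x -> S x.
  move=> Qx [Px _]; suff : (closure P `&` Q) x by rewrite PQ0.
  by [].
have cS (D : set X) : closed (set_val @^-1` closure D : set S).
  apply: preimage_closed; last exact: closed_closure.
  by move=> x _; exact: initial_continuous.
have /(normal_space_separation _ _ (cnX S) (cS P) (cS Q))[G [ O oO <-]] :
    (set_val @^-1` closure P : set S) `&` (set_val @^-1` closure Q) = set0.
  by rewrite -subset0 => x /(set_valP x).
move=> [PO OQ]; exists (O `&` S); first exact: openI.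
split=> [x Px|].
  split; last exact: SP.
  by apply: (PO (SigSub (mem_set (SP _ Px)))); exact: subset_closure.
rewrite -subset0 => x [clx Qx].
(* A point of [S] adherent to [O]&[S] in [X] is adherent to the trace of [O] in [S]. *)
suff : (closure (set_val @^-1` O : set S) `&` (set_val @^-1` closure Q))
  (SigSub (mem_set (SQ _ Qx))) by rewrite OQ.
split; last exact: subset_closure.
move=> N [_ [[B oB <-] /= Bx] sBN].
have [y [[Oy Sy] By]] := clx _ (open_nbhs_nbhs (conj oB Bx)).
by exists (SigSub (mem_set Sy)); split => //; exact: sBN.
Qed.

(** Disjoint closed sets of [S] have separated images in [X]: a point of one has a neighborhood in
    [X] whose trace on [S] misses the other. *)
Lemma normal_subspace {X : topologicalType} (R : realType) (S : set X) :
  (forall P Q : set X, closure P `&` Q = set0 -> P `&` closure Q = set0 ->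
    exists U V, [/\ open U, open V, P `<=` U, Q `<=` V & U `&` V = set0]) ->
  normal_space S.
Proof.
move=> sepX; apply/(@normal_openP R) => A B.
have sep (D E : set S) : closed D -> D `&` E = set0 ->
    closure (set_val @` D) `&` (set_val @` E) = set0.
  rewrite -openC => -[ O oO OD] DE0; rewrite -subset0 => z [+ [x Ex xz]].
  rewrite -{}xz {z} => clx.
  have nDx : (~` D) x.
    by move=> Dx; suff : (D `&` E) x by rewrite DE0.
  move: nDx; rewrite -OD => Ox.
  have [_ [[y Dy <-] Oy]] := clx _ (open_nbhs_nbhs (conj oO Ox)).
  by have : (set_val @^-1` O) y := Oy; rewrite OD.
move=> cA cB AB0; have BA0 : B `&` A = set0 by rewrite setIC.
have BA' := sep _ _ cB BA0; rewrite setIC in BA'.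
have [U [V [oU oV AU BV UV0]]] := sepX _ _ (sep _ _ cA AB0) BA'.
exists (set_val @^-1` U), (set_val @^-1` V); split.
- by exists U.
- by exists V.
- by move=> x Ax; apply: AU; exists x.
- by move=> x Bx; apply: BV; exists x.
- by rewrite -preimage_setI UV0 preimage_set0.
Qed.

(** * Monotone insertion of open sets *)

Lemma open_bigcap_finite {T : topologicalType} {I : choiceType} (D : set I)
    (F : I -> set T) : finite_set D -> (forall i, D i -> open (F i)) ->
  open (\bigcap_(i in D) F i).
Proof.
move=> finD oF; rewrite -closedC setC_bigcap; apply: closed_bigcup => // i Di.
by rewrite closedC; exact: oF.
Qed.

Section insertion.
Context {T : topologicalType} {d : Order.disp_t} {I : porderType d}.
Context {q : nat -> I} {G P Q : nat -> set T}.

(** Since the sets are to decrease when [q] increases, [above k] indexes the earlier sets that the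
    new one must contain, [below k] those that must contain it. *)
Let above k := [set i | (i < k)%N /\ (q k <= q i)%O].
Let below k := [set i | (i < k)%N /\ (q i <= q k)%O].

(* Only the values [chain k i] with [i < k] are meaningful. *)
Let chain := fix chain k : nat -> set T := if k is k'.+1 then fun i =>
    if i == k' then (\bigcup_(j in above k') chain k' j `|` G k') `&`
      \bigcap_(j in below k') chain k' j
    else chain k' i
  else fun=> set0.

Hypothesis oG : forall n, open (G n).
Hypothesis PG : forall n, P n `<=` G n.
Hypothesis GQ : forall n, closure (G n) `&` Q n = set0.
Hypothesis leP : forall i j, (q i <= q j)%O -> P j `<=` P i.
Hypothesis leQ : forall i j, (q i <= q j)%O -> Q i `<=` Q j.

Let good k := (forall i, (i < k)%N ->
    [/\ open (chain k i), P i `<=` chain k i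
      & closure (chain k i) `&` Q i = set0]) /\
  (forall i j, (i < k)%N -> (j < k)%N -> (q i <= q j)%O ->
    chain k j `<=` chain k i).

(** The new set keeps [P k], contained in [P j] for [j] in [below k], and its closure avoids [Q k],
    contained in [Q j] for [j] in [above k]. *)
Let goodS k : good k -> good k.+1.
Proof.
move=> [sepk monk].
have fin (D : set nat) : (forall i, D i -> (i < k)%N) -> finite_set D.
  by move=> Dk; apply: sub_finite_set (finite_II k) => i /Dk.
have fina : finite_set (above k) by apply: fin => i [].
have finb : finite_set (below k) by apply: fin => i [].
pose W := (\bigcup_(j in above k) chain k j `|` G k) `&`
      \bigcap_(j in below k) chain k j.
have new : chain k.+1 k = W by rewrite /= eqxx.
have old i : (i < k)%N -> chain k.+1 i = chain k i by move=> /= /ltn_eqF ->.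
(* Finiteness matters here: a finite union of closures is closed. *)
have clW : closure W `<=` \bigcup_(j in above k) closure (chain k j) `|`
    closure (G k).
  have /closure_id-> : closed (\bigcup_(j in above k) closure (chain k j) `|`
      closure (G k)).
    apply: closedU; last exact: closed_closure.
    by apply: closed_bigcup => // j _; exact: closed_closure.
  apply: closureS => x [+ _] => -[[j aj cj]|Gx].
    by left; exists j => //; exact: subset_closure.
  by right; exact: subset_closure.
split=> [i|i j]; rewrite !ltnS.
  rewrite leq_eqVlt => /predU1P[->|ik]; last by rewrite old//; exact: sepk.
  rewrite new; split.
  - apply: openI; last first.
      by apply: open_bigcap_finite => // j [jk _]; case: (sepk j).
    by apply: openU => //; apply: bigcup_open => j [jk _]; case: (sepk j).
  - move=> x Px; split; first by right; exact: PG.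
    move=> j [jk qj]; case: (sepk j jk) => _ + _; apply.
    exact: leP Px.
  - rewrite -subset0 => x [/clW[[j [jk qj] clx]|clx] Qx].
      by case: (sepk j jk) => _ _ <-; split => //; exact: leQ Qx.
    by rewrite -(GQ k).
rewrite leq_eqVlt => /predU1P[->|ik];
  rewrite leq_eqVlt => /predU1P[->|jk] qij //.
(* The cut does not remove [chain k j]: for [l] in [below k], [q l <= q k <= q j]. *)
- rewrite new old// => x cx; split; first by left; exists j.
  by move=> l [lk ql]; apply: monk cx => //; exact: le_trans qij.
- by rewrite new old// => x [_]; apply.
- by rewrite !old//; exact: monk.
Qed.

(* Inserting the sets one at a time, [G n] is enlarged by the finitely many
   earlier sets that must lie below it and cut down by those above it. *)
Lemma monotone_separation : exists W : nat -> set T,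
  [/\ forall n, open (W n), forall n, P n `<=` W n,
      forall n, closure (W n) `&` Q n = set0 &
      forall i j, (q i <= q j)%O -> W j `<=` W i].
Proof.
have gk k : good k by elim: k => [|k /goodS//]; split.
have stable n k : (n < k)%N -> chain k n = chain n.+1 n.
  elim: k => // k IH; rewrite ltnS leq_eqVlt => /predU1P[->//|nk].
  by rewrite -IH//= (ltn_eqF nk).
exists (fun n => chain n.+1 n); split=> [n|n|n|i j qij].
- by have [/(_ n (ltnSn n))[]] := gk n.+1.
- by have [/(_ n (ltnSn n))[]] := gk n.+1.
- by have [/(_ n (ltnSn n))[]] := gk n.+1.
- have [_ mon] := gk (maxn i j).+1.
  by rewrite -!(stable _ (maxn i j).+1) ?ltnS ?leq_maxl ?leq_maxr//;
    apply: mon; rewrite ?ltnS ?leq_maxl ?leq_maxr.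
Qed.

End insertion.

(** * Closed convex subsets of the unit interval *)

Section unit_interval_valued.
Context {R : realType}.
Local Open Scope ring_scope.
Implicit Types (y : unit_interval R) (C : set (unit_interval R)).

Lemma unit_interval_compact : compact [set: unit_interval R].
Proof. by apply: compact_setT_set_type; exact: segment_compact. Qed.

Lemma unit_interval_itv y : 0 <= set_val y <= 1.
Proof. by have := set_valP y; rewrite /unit_interval /= in_itv. Qed.

(** Convexity on the line is order convexity, a form that stays inside the type
    [unit_interval R]. *)
Lemma set_val_convexP C :
  @convex_set R R^o (set_val @` C) <->
  forall x y z, C x -> C z -> set_val x <= set_val y <= set_val z -> C y.
Proof.
split=> [cC x y z Cx Cz /andP[xy yz]|cC].
  have [xz|xz] := eqVneq (set_val x) (set_val z).
    suff -> : y = x by [].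
    by apply: val_inj; apply/eqP; rewrite eq_le [X in _ <= X]xz yz.
  have xz0 : 0 < set_val z - set_val x.
    by rewrite subr_gt0 lt_neqAle xz (le_trans xy yz).
  (* The weight solving [y = t * x + (1 - t) * z]. *)
  pose t := (set_val z - set_val y) / (set_val z - set_val x).
  have t0 : 0 <= t by rewrite divr_ge0 ?subr_ge0// (le_trans xy yz).
  have t1 : t <= 1 by rewrite ler_pdivrMr// mul1r lerD2l lerN2.
  have /set_mem[w Cw wE] := cC (set_val x) (set_val z) (Itv01 t0 t1)
    (mem_set (imageP _ Cx)) (mem_set (imageP _ Cz)).
  suff <- : w = y by [].
  have {}wE : set_val w = t * set_val x + (1 - t) * set_val z := wE.
  apply: val_inj; rewrite -[LHS]/(set_val w) wE /t -[RHS]/(set_val y).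
  by field; exact: lt0r_neq0.
move=> _ _ t /set_mem[x Cx <-] /set_mem[z Cz <-]; apply/mem_set.
wlog xz : x z t Cx Cz / set_val x <= set_val z.
  move=> wl; have [/wl|/ltW/wl] := leP (set_val x) (set_val z); first exact.
  by rewrite convC; apply.
have := @convR_itv R (set_val x) (set_val z) t xz.
rewrite in_itv/= => /andP[xw wz].
have Iw : unit_interval R (conv t (set_val x : R^o) (set_val z)).
  have /andP[x0 _] := unit_interval_itv x.
  have /andP[_ z1] := unit_interval_itv z.
  by rewrite /unit_interval/= in_itv/= (le_trans x0 xw) (le_trans wz z1).
exists (SigSub (mem_set Iw)) => //.
by apply: cC Cx Cz _; rewrite /= xw wz.
Qed.

Lemma closed_set_val_ge (a : R) :
  closed [set y : unit_interval R | a <= set_val y].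
Proof.
apply: (@preimage_closed _ _ set_val [set r | a <= r]); last exact: closed_ge.
by move=> y _; exact: initial_continuous.
Qed.

Lemma closed_set_val_le (a : R) :
  closed [set y : unit_interval R | set_val y <= a].
Proof.
apply: (@preimage_closed _ _ set_val [set r | r <= a]); last exact: closed_le.
by move=> y _; exact: initial_continuous.
Qed.

Lemma open_set_val_gt (a : R) :
  open [set y : unit_interval R | a < set_val y].
Proof. by exists [set r | a < r] => //; exact: open_gt. Qed.

Lemma open_set_val_lt (a : R) :
  open [set y : unit_interval R | set_val y < a].
Proof. by exists [set r | r < a] => //; exact: open_lt. Qed.

(** The boolean puts lower and upper bounds into one family, so that a multi-valued map can be a
    single intersection. *)
Definition halfline (a : R) (b : bool) : set (unit_interval R) :=
  if b then [set y | a <= set_val y] else [set y | set_val y <= a].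

Lemma closed_halfline a b : closed (halfline a b).
Proof. by case: b; [exact: closed_set_val_ge|exact: closed_set_val_le]. Qed.

Lemma nonempty_closed_convex_halflines {I : Type} (D : set I) (a : I -> R)
    (b : I -> bool) :
  \bigcap_(i in D) halfline (a i) (b i) !=set0 ->
  nonempty_closed_convex (\bigcap_(i in D) halfline (a i) (b i)).
Proof.
move=> ne; split=> //.
  by apply: closed_bigI => i _; exact: closed_halfline.
apply/set_val_convexP => x y z Cx Cz /andP[xy yz] i Di.
have := Cx i Di; have := Cz i Di; rewrite /halfline; case: (b i) => /= zi xi.
- exact: le_trans xy.
- exact: le_trans zi.
Qed.

Lemma unit_interval_dense_seq : exists2 q : nat -> R,
  forall n, 0 <= q n <= 1 &
  forall a b, 0 <= a -> a < b -> b <= 1 -> exists n, a < q n < b.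
Proof.
(* The enumerated rationals, with default 0, clamped to [[0, 1]]; clamping fixes those already
   there. *)
pose q n : R := Num.min 1 (Num.max 0 (ratr (odflt 0 (unpickle n)))).
exists q => [n|a b a0 ab b1].
  by rewrite /q le_min ler01 le_max lexx/= ge_min lexx.
have [r] := rat_in_itvoo ab; rewrite in_itv/= => /andP[ar rb].
exists (pickle r); rewrite /q pickleK/=.
have r0 : 0 <= ratr r :> R by exact: le_trans (ltW ar).
by rewrite max_r// min_r ?ar// (le_trans (ltW rb)).
Qed.

(** A point [y] outside [C] is at distance at least some [e > 0] from [C] by closedness, and [C]
    lies on one side of it by convexity; some [q n] in the gap then contradicts a hypothesis. *)
Lemma nonempty_closed_convex_cut C y (q : nat -> R) :
  nonempty_closed_convex C ->
  (forall a b, 0 <= a -> a < b -> b <= 1 -> exists n, a < q n < b) ->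
  (forall n, C `<=` [set z | q n < set_val z] -> q n <= set_val y) ->
  (forall n, C `<=` [set z | set_val z < q n] -> set_val y <= q n) ->
  C y.
Proof.
move=> [[c Cc] cC /set_val_convexP iC] dq gtq ltq; apply: contrapT => nCy.
have [ O oO OC] : open (~` C) by exact: closed_openC.
have Oy : O (set_val y) by have : (set_val @^-1` O) y by rewrite OC.
have /nbhs_ballP[e /= e0 eO] : nbhs (set_val y) O by exact: open_nbhs_nbhs.
have far z : C z -> e <= `|set_val y - set_val z|.
  move=> Cz; rewrite leNgt; apply/negP => yz.
  by have : (set_val @^-1` O) z := eO _ yz; rewrite OC.
have /andP[y0 y1] := unit_interval_itv y.
have /andP[c0 c1] := unit_interval_itv c.
have [yc|cy] := leP (set_val y) (set_val c).
- have up z : C z -> set_val y < set_val z.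
    move=> Cz; rewrite ltNge; apply/negP => zy; apply: nCy.
    by apply: (iC z y c) => //; rewrite zy.
  have up' z : C z -> set_val y + e <= set_val z.
    move=> Cz; have := far z Cz; have yz := up z Cz.
    by rewrite distrC gtr0_norm ?subr_gt0// lerBrDl.
  have [n /andP[yn ny]] : exists n, set_val y < q n < set_val y + e.
    by apply: dq; rewrite ?ltrDl// (le_trans (up' c Cc)).
  suff : q n <= set_val y by rewrite leNgt yn.
  by apply: gtq => z /up' /=; exact: lt_le_trans.
- have dn z : C z -> set_val z < set_val y.
    move=> Cz; rewrite ltNge; apply/negP => yz; apply: nCy.
    by apply: (iC c y z) => //; rewrite (ltW cy).
  have dn' z : C z -> set_val z <= set_val y - e.
    move=> Cz; have := far z Cz; have zy := dn z Cz.
    by rewrite gtr0_norm ?subr_gt0// lerBrDl addrC -lerBrDl.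
  have [n /andP[yn ny]] : exists n, set_val y - e < q n < set_val y.
    by apply: dq; rewrite ?ltrBlDr ?ltrDl// (le_trans c0 (dn' c Cc)).
  suff : set_val y <= q n by rewrite leNgt ny.
  by apply: ltq => z /dn' /= zy; exact: le_lt_trans yn.
Qed.

(** * Extension over a completely normal space *)

Lemma upper_semicontinuous_extension {X : topologicalType} {A : set X}
    {T : A -> set (unit_interval R)} :
  completely_normal X -> closed A -> upper_semicontinuous T ->
  (forall x : A, nonempty_closed_convex (T x)) ->
  exists Text : X -> set (unit_interval R),
    [/\ upper_semicontinuous Text,
        forall x : X, nonempty_closed_convex (Text x) &
        forall x : A, Text (set_val x) = T x].
Proof.
move=> cnX cA uT ncT; have [q q01 dq] := unit_interval_dense_seq.
have /choice[Op Opp] n : exists O : set X, open O /\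
    forall x : A, O (set_val x) <-> T x `<=` [set z | q n < set_val z].
  have [ O ? ?] := upper_semicontinuous_trace _ uT (open_set_val_gt (q n)).
  by exists O.
have /choice[Oq Oqp] n : exists O : set X, open O /\
    forall x : A, O (set_val x) <-> T x `<=` [set z | set_val z < q n].
  have [ O ? ?] := upper_semicontinuous_trace _ uT (open_set_val_lt (q n)).
  by exists O.
have oOp n : open (Op n) by case: (Opp n).
have oOq n : open (Oq n) by case: (Oqp n).
have OpE n (x : A) : Op n (set_val x) <-> T x `<=` [set z | q n < set_val z].
  by case: (Opp n).
have OqE n (x : A) : Oq n (set_val x) <-> T x `<=` [set z | set_val z < q n].
  by case: (Oqp n).
have inA x : A x -> exists x' : A, x = set_val x'.
  by move=> Ax; exists (SigSub (mem_set Ax)).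
pose P n := A `&` Op n; pose Q n := A `&` Oq n.
have disj n x : A x -> Op n x -> Oq n x -> False.
  move=> /inA[x' ->{x}] /OpE gt /OqE lt; have [[y Ty] _ _] := ncT x'.
  by have := lt_trans (gt y Ty) (lt y Ty); rewrite ltxx.
have /choice[G Gp] n : exists G : set X, [/\ open G, P n `<=` G
    & closure G `&` Q n = set0].
  have [||G oG [? ?]] :=
    completely_normal_separation (P n) (Q n) cnX; last first.
  - by exists G.
  - rewrite -subset0 => x [[Ax Opx]].
    move=> /(_ (Op n) (open_nbhs_nbhs (conj (oOp n) Opx))).
    by move=> [z [[Az Oqz] Opz]]; exact: disj Opz Oqz.
  - rewrite -subset0 => x [+ [Ax Oqx]].
    move=> /(_ (Oq n) (open_nbhs_nbhs (conj (oOq n) Oqx))).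
    by move=> [z [[Az Opz] Oqz]]; exact: disj Opz Oqz.
have [W [oW PW WQ leW]] : exists W : nat -> set X,
    [/\ forall n, open (W n), forall n, P n `<=` W n,
      forall n, closure (W n) `&` Q n = set0 &
      forall i j, q i <= q j -> W j `<=` W i].
  apply: (@monotone_separation _ _ _ q G) => [n|n|n|i j qij x|i j qij x].
  - by case: (Gp n).
  - by case: (Gp n).
  - by case: (Gp n).
  - move=> [Ax Opx]; split=> //; move: Opx; have [x' ->] := inA x Ax.
    move=> /OpE gt; apply/OpE => y /gt /=; exact: le_lt_trans.
  - move=> [Ax Oqx]; split=> //; move: Oqx; have [x' ->] := inA x Ax.
    move=> /OqE lt; apply/OqE => y /lt /= yq; exact: lt_le_trans qij.
(* On [A], [U n] and [V n] reduce to [P n] and [Q n], so no constraint foreign to [T] is active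
   there. *)
pose U n := W n `&` (~` A `|` Op n).
pose V n := ~` closure (W n) `&` (~` A `|` Oq n).
pose O i := if i.2 then U i.1 else V i.1.
pose Text x := \bigcap_(i in [set i : nat * bool | O i x]) halfline (q i.1) i.2.
have oO i : open (O i).
  rewrite /O; case: i.2; apply: openI => //.
  - by apply: openU => //; exact: closed_openC.
  - by apply: closed_openC; exact: closed_closure.
  - by apply: openU => //; exact: closed_openC.
exists Text; split=> [|x|x].
- apply: upper_semicontinuous_bigcap => //; first exact: unit_interval_compact.
  by move=> i; exact: closed_halfline.
- apply: nonempty_closed_convex_halflines.
  (* The point of [Text x] is the supremum of the active lower bounds; 0 is added to make [E]
     nonempty. *)
  pose E := [set r : R | r = 0 \/ exists2 n, U n x & r = q n].
  have E1 : ubound E 1.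
    by move=> r [->|[n _ ->]]; [exact: ler01|case/andP: (q01 n)].
  have E0 : E 0 by left.
  have Es : has_ubound E by exists 1.
  have s01 : unit_interval R (sup E).
    rewrite /unit_interval/= in_itv/=; apply/andP; split.
      exact: ub_le_sup.
    by apply: ge_sup => //; exists 0.
  exists (SigSub (mem_set s01)) => -[n b]; rewrite /O/halfline /=.
  case: b => /= [Unx|[nWx _]].
    by apply: ub_le_sup => //; right; exists n.
  apply: ge_sup; first by exists 0.
  move=> r [->|[m [Wmx _] ->]]; first by case/andP: (q01 n).
  (* If [q n < q m], then [x] in [W m] lies in [W n], although it is outside [closure (W n)]. *)
  rewrite leNgt; apply/negP => /ltW/leW Wmn.
  by apply: nWx; apply: subset_closure; exact: Wmn.
- rewrite eqEsubset; split=> y.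
    (* Each [q n] strictly on one side of [T x] is an active constraint, and these determine
       [T x]. *)
    move=> Ty; apply: (nonempty_closed_convex_cut _ _ q (ncT x) dq) => n Tq.
      have Opx : Op n (set_val x) by apply/OpE.
      apply: (Ty (n, true)) => /=; split; last by right.
      by apply: PW; split => //; exact: set_valP.
    have Oqx : Oq n (set_val x) by apply/OqE.
    apply: (Ty (n, false)) => /=; split; last by right.
    move=> clx; have : (closure (W n) `&` Q n) (set_val x).
      by split => //; split => //; exact: set_valP.
    by rewrite WQ.
  move=> Ty [n b]; rewrite /O/halfline/=.
  case: b => /= -[_ [/(_ (set_valP x))//|]].
    by move=> /OpE/(_ y Ty)/ltW.
  by move=> /OqE/(_ y Ty)/ltW.
Qed.

(** * Separation from the extension property *)

Lemma separation_of_extension {X : topologicalType} (P Q : set X) :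
  (forall A : set X, closed A ->
   forall T : A -> set (unit_interval R),
     upper_semicontinuous T ->
     (forall x : A, nonempty_closed_convex (T x)) ->
     exists Text : X -> set (unit_interval R),
       [/\ upper_semicontinuous Text,
           forall x : X, nonempty_closed_convex (Text x) &
           forall x : A, Text (set_val x) = T x]) ->
  closure P `&` Q = set0 -> P `&` closure Q = set0 ->
  exists U V, [/\ open U, open V, P `<=` U, Q `<=` V & U `&` V = set0].
Proof.
move=> ext PQ0 QP0; pose A := closure P `|` closure Q.
(* [true] imposes [1 <= y] off [closure Q], [false] imposes [y <= 0] off [closure P]. *)
pose O (b : bool) : set A := set_val @^-1` (~` closure (if b then Q else P)).
pose T x := \bigcap_(b in [set b | O b x]) halfline b%:R b.
have cA : closed A by apply: closedU; exact: closed_closure.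
have oO b : open (O b).
  by exists (~` closure (if b then Q else P)) => //; apply: closed_openC;
    exact: closed_closure.
have uT : upper_semicontinuous T.
  apply: upper_semicontinuous_bigcap => //; first exact: unit_interval_compact.
  by move=> b; exact: closed_halfline.
have PA x : P x -> A x by move=> Px; left; exact: subset_closure.
have QA x : Q x -> A x by move=> Qx; right; exact: subset_closure.
(* The two constraints are never active together on [A], so the values are nonempty. *)
have nPQ x : ~ (~ closure P (set_val x) /\ ~ closure Q (set_val (x : A))).
  by have [?|?] := set_valP x; case.
have ncT x : nonempty_closed_convex (T x).
  apply: nonempty_closed_convex_halflines.
  have I0 : unit_interval R 0 by rewrite /unit_interval/= in_itv/= lexx ler01.
  have I1 : unit_interval R 1 by rewrite /unit_interval/= in_itv/= lexx ler01.
  have [clQ|nclQ] := pselect (closure Q (set_val x)).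
    by exists (SigSub (mem_set I0)) => -[]/=; rewrite /O/halfline/= ?lexx.
  exists (SigSub (mem_set I1)) => -[]/=; rewrite /O/halfline/= ?lexx//.
  by move=> nclP; case: (nPQ x).
have [S [uS ncS ST]] := ext A cA T uT ncT.
have oS (V : set (unit_interval R)) : open V -> open [set x | S x `<=` V].
  by move=> oV; rewrite openE => x /= SV; exact: uS.
exists [set x | S x `<=` [set z | 2^-1 < set_val z]],
  [set x | S x `<=` [set z | set_val z < 2^-1]]; split.
- by apply: oS; exact: open_set_val_gt.
- by apply: oS; exact: open_set_val_lt.
- move=> x Px; pose x' : A := SigSub (mem_set (PA x Px)).
  rewrite -[x]/(set_val x') /= ST => z /(_ true) zT.
  have : 1 <= set_val z.
    by apply: zT => /= Qx; have : (P `&` closure Q) x by []; rewrite QP0.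
  by apply: lt_le_trans; rewrite invf_lt1// ltr1n.
- move=> x Qx; pose x' : A := SigSub (mem_set (QA x Qx)).
  rewrite -[x]/(set_val x') /= ST => z /(_ false) zT.
  have : set_val z <= 0.
    by apply: zT => /= Px; have : (closure P `&` Q) x by []; rewrite PQ0.
  by move=> z0; apply: (le_lt_trans z0); rewrite invr_gt0 ltr0n.
(* Disjointness comes from the nonempty values of [S]. *)
- rewrite -subset0 => x [/= gt lt]; have [[y Sy] _ _] := ncS x.
  by have := lt_trans (gt y Sy) (lt y Sy); rewrite ltxx.
Qed.

End unit_interval_valued.

Theorem corollary1 (R : realType) (X : topologicalType)
    (hX : hausdorff_space X) :
  completely_normal X <->
  (forall (A : set X), closed A ->
   forall (T : A -> set (unit_interval R)),
     upper_semicontinuous T ->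
     (forall x : A, nonempty_closed_convex (T x)) ->
     exists Text : X -> set (unit_interval R),
       [/\ upper_semicontinuous Text,
           forall x : X, nonempty_closed_convex (Text x) &
           forall x : A, Text (set_val x) = T x]).
Proof.
split=> [cnX A cA T uT ncT|ext S]; first exact: upper_semicontinuous_extension.
apply: (normal_subspace R) => P Q.
exact: (separation_of_extension P Q ext).
Qed.
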